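(* Let $t \ge 3$ be an integer and let $G$ be a finite simple connected $r$-regular graph on $n$ vertices such that $M_t(G)$ is a distance magic graph. Then $r < 2t + \frac{2}{n+1}$.
   Context: For a graph $G=(V,E)$ and an integer $t \ge 1$, the generalised Mycielskian $M_t(G)$ is the graph with vertex set $(V \times \{0,1,\dots,t-1\}) \cup \{u\}$ (where $u$ is a new vertex), whose edges are: $(x,0)(y,0)$ for every edge $xy \in E$; $(x,i)(y,i+1)$ for every $0 \le i \le t-2$ and every ordered pair $(x,y)$ with $xy \in E$; and $(x,t-1)u$ for every $x \in V$. A graph $H$ on $N$ vertices is distance magic if there is a bijection $f: V(H) \to \{1,2,\dots,N\}$ and a constant $k$ such that for every vertex $v$, $\sum_{w \in N(v)} f(w) = k$, where $N(v)$ is the open neighbourhood of $v$. *)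

(* Defs.v *)
From mathcomp Require Import all_boot all_order all_algebra.

Set Implicit Arguments.
Unset Strict Implicit.
Unset Printing Implicit Defensive.

(* A finite graph is given by its adjacency relation on a finType. *)

Definition simple_graph (V : finType) (e : rel V) : Prop :=
  symmetric e /\ irreflexive e.

Definition neighbours (V : finType) (e : rel V) (v : V) : {set V} :=
  [set w | e v w].

Definition regular_graph (V : finType) (e : rel V) (r : nat) : Prop :=
  forall v, #|neighbours e v| = r.

(* The graph with no vertex is not connected. *)
Definition connected_graph (V : finType) (e : rel V) : Prop :=
  0 < #|V| /\ forall x y, connect e x y.

(* In M_t(G), [Some (x, i)] is the vertex (x, i) and [None] is the new
   vertex u. *)
Definition mycielskian (t : nat) (V : finType) (e : rel V) :
    rel (option (V * 'I_t)) :=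
  fun p q =>
    match p, q with
    | Some (x, i), Some (y, j) =>
        e x y && [|| (i == 0 :> nat) && (j == 0 :> nat),
                     j == i.+1 :> nat | i == j.+1 :> nat]
    | Some (_, i), None | None, Some (_, i) => i == t.-1 :> nat
    | None, None => false
    end.

Lemma mycielskian_simple (t : nat) (V : finType) (e : rel V) :
  simple_graph e -> simple_graph (@mycielskian t V e).
Proof.
case=> sym irr; split; last by case=> [[x i]|] //=; rewrite irr.
case=> [[x i]|] [[y j]|] //=; rewrite sym; congr (_ && _).
by rewrite andbC [X in _ || X]orbC.
Qed.

(* The second conjunct says that the image of f is {1, ..., #|V|}. *)
Definition distance_magic (V : finType) (e : rel V) : Prop :=
  exists (f : V -> nat) (k : nat),
    [/\ injective f,
        forall m, (exists v, f v = m) <-> (1 <= m <= #|V|)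
      & forall v, \sum_(w in neighbours e v) f w = k].

(* Main.v *)
Require Import Defs.
From mathcomp Require Import all_boot all_order all_algebra.
From mathcomp Require Import zify.
Import Order.TTheory GRing.Theory Num.Theory.
Local Open Scope ring_scope.

Set Implicit Arguments.
Unset Strict Implicit.
Unset Printing Implicit Defensive.

(** Let L_i be the sum of the labels on layer i. Summing the magic condition
    over a layer gives r (L_0 + L_1) = n k and r (L_(i-1) + L_(i+1)) = n k, so
    two consecutive layers either have equal sums or satisfy
    r (L_i + L_(i+1)) = n k. The new vertex gives L_(t-1) = k and the last layer
    gives r L_(t-2) + n f(u) = n k. Combining these for the layers t-2 and t-1,
    one of L_(t-1), L_(t-3) equals n f(u) / r. A layer carries n distinct
    positive labels, so n (n + 1) / 2 <= n f(u) / r, while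
    f(u) <= n t + 1. *)

(** Induction on [#|A|], removing an element where [g] is largest: its value is at least [#|A|]. *)
Lemma injective_sum_ge (T : finType) (g : T -> nat) (A : {set T}) :
  injective g -> (forall x, 0 < g x)%N ->
  (#|A| * #|A|.+1 <= 2 * \sum_(x in A) g x)%N.
Proof.
move=> g_inj g_gt0; move cardA: #|A| => m.
elim: m A cardA => [|m IHm] A cardA //.
have /card_gt0P[x0 Ax0] : (0 < #|A|)%N by rewrite cardA.
case: (arg_maxnP g Ax0) => x xA g_le.
have Ax : x \in A by [].
(* The values of [g] on [A] are [m.+1] distinct members of [1, ..., g x]. *)
have le_m_gx : (m.+1 <= g x)%N.
  rewrite -cardA cardE -(size_map g) -(size_iota 1 (g x)).
  apply: uniq_leq_size; first by rewrite map_inj_uniq ?enum_uniq.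
  move=> _ /mapP[y + ->]; rewrite mem_enum mem_iota => Ay.
  by rewrite g_gt0 add1n ltnS; apply: g_le.
have := IHm (A :\ x); rewrite (big_setD1 x Ax) /=.
have -> : #|A :\ x| = m by move: (cardsD1 x A); rewrite Ax cardA add1n => -[].
by move=> /(_ erefl); nia.
Qed.

Lemma sum_pred2 (T : finType) (P : pred T) (F : T -> nat) (a b : T) :
  a != b -> P =1 pred2 a b -> (\sum_(j | P j) F j = F a + F b)%N.
Proof.
move=> neq_ab PE; rewrite (eq_bigl _ _ PE) (bigD1 a) /= ?eqxx //; congr addn.
rewrite (big_pred1 b) // => j /=; case: (eqVneq j a) => [->|_] /=.
  by rewrite (negPf neq_ab).
by rewrite andbT.
Qed.

(** Double counting: by symmetry each [g y] occurs once for each of the [r] neighbours of [y]. *)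
Lemma sum_neighbours_regular (V : finType) (e : rel V) (r : nat) (g : V -> nat) :
  symmetric e -> regular_graph e r ->
  (\sum_x \sum_(y | e x y) g y = r * \sum_y g y)%N.
Proof.
move=> e_sym regG; rewrite (exchange_big_dep xpredT) //= big_distrr /=.
apply: eq_bigr => y _; rewrite sum_nat_const; congr muln.
by rewrite -(regG y); apply: eq_card => x; rewrite !inE e_sym.
Qed.

(** The layer part of [mycielskian]: a path on the layers with a loop at layer 0. *)
Definition layer_adj (i j : nat) : bool :=
  [|| (i == 0%N) && (j == 0%N), j == i.+1 | i == j.+1].

Definition layer_sum (V : finType) (t : nat) (f : option (V * 'I_t) -> nat)
  (j : 'I_t) : nat := (\sum_x f (Some (x, j)))%N.

Lemma sum_option (T : finType) (P : pred (option T)) (F : option T -> nat) :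
  (\sum_(w | P w) F w = P None * F None + \sum_(x | P (Some x)) F (Some x))%N.
Proof.
rewrite big_mkcond (bigD1 None) //=; congr addn; first by case: (P None); lia.
rewrite [RHS]big_mkcond /= (reindex_omap Some id) => [|[]] //=.
by apply: eq_bigl => x; rewrite eqxx.
Qed.

Lemma sum_mycielskian_neighbours (V : finType) (e : rel V) (t : nat)
    (f : option (V * 'I_t) -> nat) (x : V) (i : 'I_t) :
  (\sum_(w in neighbours (@mycielskian t V e) (Some (x, i))) f w
   = (i == t.-1 :> nat) * f None
     + \sum_(j : 'I_t | layer_adj i j) \sum_(y | e x y) f (Some (y, j)))%N.
Proof.
rewrite exchange_big pair_big_dep /=.
under eq_bigl => w do rewrite inE.
by rewrite sum_option /=; congr addn; apply: eq_big => [[y j]|[y j]].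
Qed.

Section MagicLayers.

Variables (V : finType) (e : rel V) (t r k : nat).
Variable f : option (V * 'I_t) -> nat.
Hypotheses (e_sym : symmetric e) (regG : regular_graph e r).
Hypothesis magic :
  forall v, (\sum_(w in neighbours (@mycielskian t V e) v) f w = k)%N.

Lemma layer_sum_eq (i : 'I_t) :
  (#|V| * ((i == t.-1 :> nat) * f None)
     + r * \sum_(j : 'I_t | layer_adj i j) layer_sum f j = #|V| * k)%N.
Proof.
transitivity (\sum_(x : V) k)%N; last by rewrite sum_nat_const.
rewrite -(eq_bigr _ (fun x _ => magic (Some (x, i)))).
under [RHS]eq_bigr => x _ do rewrite sum_mycielskian_neighbours.
rewrite big_split /= sum_nat_const; congr addn.
rewrite [RHS]exchange_big big_distrr /=; apply: eq_bigr => j _.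
by rewrite (sum_neighbours_regular (fun y => f (Some (y, j))) e_sym regG).
Qed.

(** The last layer is exactly the neighbourhood of [None]. *)
Lemma last_layer_sum (j : 'I_t) : j = t.-1 :> nat -> layer_sum f j = k.
Proof.
move=> jE; rewrite -(magic None).
under [RHS]eq_bigl => w do rewrite inE.
rewrite sum_option /= mul0n add0n.
transitivity (\sum_x \sum_(i : 'I_t | i == t.-1 :> nat) f (Some (x, i)))%N.
  apply: eq_bigr => x _; rewrite (big_pred1 j) // => i.
  by rewrite /= -val_eqE /= jE.
by rewrite pair_big_dep /=; apply: eq_big => [[x i]|[x i]].
Qed.

End MagicLayers.

Lemma magic_mycielskian_bound (V : finType) (e : rel V) (t r : nat) :
  (3 <= t)%N -> symmetric e -> regular_graph e r -> (0 < r)%N -> (0 < #|V|)%N ->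
  distance_magic (@mycielskian t V e) ->
  (r * #|V|.+1 <= 2 * (#|V| * t).+1)%N.
Proof.
case: t => [|[|[|s]]] // _ e_sym regG r_gt0 V_gt0 [f [k [f_inj f_img magic]]].
(* Indexing by [nat] lets [i.+1] and [i.+2] be written freely; [inord] is faithful only below
   [s.+3], hence the range conditions below. *)
pose L (i : nat) := layer_sum f (inord i : 'I_s.+3).
have layerE := @layer_sum_eq V e s.+3 r k f e_sym regG magic.
(* The loop at layer 0 contributes the term [L 0]. *)
have layer0 : (r * (L 0 + L 1) = #|V| * k)%N.
  rewrite -(layerE (inord 0)) inordK // muln0 add0n.
  rewrite (@sum_pred2 _ _ _ (inord 0) (inord 1)) //.
    by rewrite -val_eqE /= !inordK.
  by move=> j; rewrite /= -!val_eqE /= !inordK // /layer_adj; lia.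
have layerM i : (i.+2 < s.+3)%N -> (r * (L i + L i.+2) = #|V| * k)%N.
  move=> lti; rewrite -(layerE (inord i.+1)) inordK; last by lia.
  rewrite (_ : i.+1 == s.+3.-1 = false); last by lia.
  rewrite muln0 add0n (@sum_pred2 _ _ _ (inord i) (inord i.+2)) //.
    by rewrite -val_eqE /= !inordK //; lia.
  by move=> j; rewrite /= -!val_eqE /= !inordK // /layer_adj; lia.
have layerT : (#|V| * f None + r * L s.+1 = #|V| * k)%N.
  rewrite -(layerE (inord s.+2)) inordK // eqxx mul1n (big_pred1 (inord s.+1)) //.
  move=> j; rewrite /= -val_eqE /= inordK // /layer_adj.
  by have := ltn_ord j; lia.
have L_last : L s.+2 = k by apply: (last_layer_sum magic); rewrite inordK.
(* The two alternatives swap at each step: if [L i = L i.+1], substitute into [layerM i]; otherwise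
   compare with [layerM i] and cancel [r]. *)
have L_step i : (i.+1 < s.+3)%N ->
    L i = L i.+1 \/ (r * (L i + L i.+1) = #|V| * k)%N.
  elim: i => [|i IHi] lti; first by right.
  have [|Li|Li] := IHi; first by lia.
    by right; rewrite -Li; apply: layerM.
  left; have := layerM i lti; rewrite -Li => /eqP.
  by rewrite eqn_pmul2l // eqn_add2l => /eqP.
have f_gt0 w : (0 < f w)%N by have /f_img/andP[] : exists v, f v = f w by exists w.
have fu_le : (f None <= (#|V| * s.+3).+1)%N.
  have /f_img/andP[_] : exists v, f v = f None by exists None.
  by rewrite card_option card_prod card_ord.
have L_ge i : (#|V| * #|V|.+1 <= 2 * L i)%N.
  have := @injective_sum_ge V (fun x => f (Some (x, inord i))) setT.
  rewrite cardsT; under eq_bigl do rewrite inE.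
  by apply=> // x y /f_inj[].
have [i rLi] : exists i, (r * L i = #|V| * f None)%N.
  (* Compare [layerT] with [layerM s] if the last two layers have equal sums, and with [Ls] itself
     otherwise. *)
  have /(_ (ltnSn _))[Ls|Ls] := L_step s.+1.
    by exists s; have := layerM s (ltnSn _); lia.
  by exists s.+2; lia.
have ge_i := L_ge i.
suff : (r * #|V|.+1 <= 2 * f None)%N by lia.
(* After multiplication by [#|V|], this is [ge_i] times [r], rewritten by [rLi]. *)
by rewrite -(leq_pmul2l V_gt0); nia.
Qed.

Theorem theorem2p13 (V : finType) (e : rel V) (t r n : nat)
  (ht : (3 <= t)%N)
  (simpleG : simple_graph e)
  (connG : connected_graph e)
  (regG : regular_graph e r)
  (cardG : #|V| = n)
  (magicM : distance_magic (@mycielskian t V e)) :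
  r%:R < 2 * t%:R + 2 / (n%:R + 1) :> rat.
Proof.
case: simpleG connG => e_sym _ [V_gt0 _].
have n1_gt0 : 0 < n%:R + 1 :> rat by rewrite natr1 ltr0n.
(* Clearing the denominator [n + 1] leaves an inequality in [nat]. It is strict because
   [2 * (n * t).+1] falls short of the right side by [2 * t]. *)
suff lt_nat : (r * n.+1 < 2 * t * n.+1 + 2)%N.
  rewrite -(ltr_pM2r n1_gt0) mulrDl divfK ?gt_eqF // natr1.
  by rewrite -!natrM -natrD ltr_nat.
(* The case [r = 0] is separate, since the bound was obtained by cancelling [r]. *)
have [->|r_gt0] := posnP r; first by rewrite mul0n addn2.
have := magic_mycielskian_bound ht e_sym regG r_gt0 V_gt0 magicM.
by rewrite cardG; nia.
Qed.
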